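(* Let $r>s\ge 1$ be integers, and let $G$ be a $K_{r+1}$-free graph on $n$ vertices. Suppose that $m$ is an integer with \[ \alpha_s(G)\ge m\ge \left\lceil \frac{sn}{r}\right\rceil . \] Then \[ e(G)\le m(n-m)+t_{r-s}(n-m)+t_s(m). \] Moreover, equality holds if and only if $G$ is a complete $r$-partite graph whose parts can be divided into two groups: $s$ parts with total size $m$, as equal as possible, and $r-s$ parts with total size $n-m$, as equal as possible.
   Context: All graphs are finite, simple and undirected; $e(G)$ is the number of edges of $G$, and $G[M]$ is the subgraph induced by $M\subseteq V(G)$. A graph is $F$-free if it contains no (not necessarily induced) subgraph isomorphic to $F$. For $s\ge 1$, \[ \alpha_s(G)=\max\{|M|: M\subseteq V(G)\text{ and } G[M]\text{ is }K_{s+1}\text{-free}\}. \] A graph is complete $r$-partite if its vertex set can be partitioned into $r$ independent sets (parts) such that every two vertices from distinct parts are adjacent; parts of size zero are allowed. ''As equal as possible'' means that the sizes of any two parts within the group differ by at most one. The Turán graph $T_r(n)$ is the complete $r$-partite graph on $n$ vertices in which any two part sizes differ by at most one, and $t_r(n)=e(T_r(n))$, with $t_r(0)=0$. *)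

(* Defs.v *)
From mathcomp Require Import all_boot.

Set Implicit Arguments.
Unset Strict Implicit.
Unset Printing Implicit Defensive.

Record sgraph := SGraph {
  vertex :> finType;
  adj : rel vertex;
  adj_sym : symmetric adj;
  adj_irrefl : irreflexive adj }.

Definition edges (G : sgraph) : {set {set G}} :=
  [set e : {set G} | [exists x, exists y, adj x y && (e == [set x; y])]].

Definition num_edges (G : sgraph) : nat := #|edges G|.

Section Induced.
Variables (G : sgraph) (M : {set G}).
Definition induced_adj : rel {x : G | x \in M} := fun u v => adj (val u) (val v).
Lemma induced_adj_sym : symmetric induced_adj.
Proof. by move=> u v; apply: adj_sym. Qed.
Lemma induced_adj_irrefl : irreflexive induced_adj.
Proof. by move=> u; apply: adj_irrefl. Qed.
Definition induced : sgraph := SGraph induced_adj_sym induced_adj_irrefl.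
End Induced.

(* An injective edge-preserving map is the same as an isomorphism from F onto
   a subgraph of G that need not be induced. *)
Definition contains (F G : sgraph) : bool :=
  [exists f : {ffun F -> G},
     injectiveb f && [forall x, forall y, adj x y ==> adj (f x) (f y)]].

Definition graph_free (F G : sgraph) : bool := ~~ contains F G.

Section Separated.
Variables (T : finType) (I : eqType) (c : T -> I).
Definition separated : rel T := fun x y => c x != c y.
Lemma separated_sym : symmetric separated.
Proof. by move=> x y; rewrite /separated eq_sym. Qed.
Lemma separated_irrefl : irreflexive separated.
Proof. by move=> x; rewrite /separated eqxx. Qed.
Definition separated_graph : sgraph := SGraph separated_sym separated_irrefl.
End Separated.

Definition complete_graph (n : nat) : sgraph := separated_graph (@id 'I_n).

Definition alpha (s : nat) (G : sgraph) : nat :=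
  \max_(M : {set G} | graph_free (complete_graph s.+1) (induced M)) #|M|.

(* A division of the vertices into r labelled, possibly empty, parts is given
   by the map c sending each vertex to the label of its part. *)
Definition part (G : sgraph) (r : nat) (c : G -> 'I_r) (i : 'I_r) : {set G} :=
  [set x | c x == i].

Definition complete_partite (G : sgraph) (r : nat) (c : G -> 'I_r) : Prop :=
  forall x y : G, adj x y = (c x != c y).

Definition balanced (G : sgraph) (r : nat) (c : G -> 'I_r) (S : {set 'I_r}) :
    Prop :=
  {in S &, forall i j, #|part c i| <= #|part c j| + 1}.

(* For 0 < r the parts are the residue classes modulo r; turan_graphP below
   checks that this is the balanced complete r-partite graph. *)
Definition turan_graph (r n : nat) : sgraph :=
  separated_graph (fun i : 'I_n => i %% r).

Definition turan (r n : nat) : nat := num_edges (turan_graph r n).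

Lemma card_residue (r n k : nat) : k < r ->
  #|[set i : 'I_n | i %% r == k]| = n %/ r + (k < n %% r).
Proof.
move=> ltkr; have r0 : 0 < r by apply: leq_ltn_trans ltkr.
have -> : #|[set i : 'I_n | i %% r == k]| = \sum_(i < n) (i %% r == k).
  by rewrite -sum1_card big_mkcond; apply: eq_bigr => i _; rewrite inE; case: eqP.
elim: n => [|n IHn]; first by rewrite big_ord0 div0n mod0n.
rewrite big_ord_recr /= IHn divnS // modnS.
have ltnr := ltn_pmod n r0.
case: ifP => [dv|ndv].
  have e : (n %% r).+1 = r.
    have : r %| (n %% r).+1 by rewrite /dvdn -addn1 modnDml addn1.
    by move/dvdn_leq => /(_ isT) h; apply/eqP; rewrite eqn_leq h ltnr.
  have : k <= n %% r by rewrite -ltnS e.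
  by rewrite ltn0 addn0 add1n -addnA; case: ltngtP => //= _ _; rewrite ?addn0 ?add0n addn1.
by rewrite add0n -addnA ltnS; case: ltngtP.
Qed.

Lemma turan_graphP (r n : nat) : 0 < r ->
  exists c : turan_graph r n -> 'I_r,
    complete_partite c /\ balanced c [set: 'I_r].
Proof.
move=> r0; exists (fun i : 'I_n => Ordinal (ltn_pmod i r0)).
split=> [x y //|i j _ _].
have cE k : #|part (fun i : turan_graph r n => Ordinal (ltn_pmod (i : 'I_n) r0)) k|
    = n %/ r + (k < n %% r).
  rewrite -(card_residue n (ltn_ord k)); apply: eq_card => x.
  by rewrite !inE -val_eqE.
rewrite !cE -addnA leq_add2l.
by case: (i < _); case: (j < _).
Qed.

(* Main.v *)
(* Fix M of size exactly m whose cliques have at most s vertices, and induct on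
   the number of vertices. If fewer than r - s vertices lie outside M, Turan's
   theorem inside M gives the bound. Otherwise extend a maximal clique to a set W
   of r vertices with at most s of them in M: every vertex outside W misses a
   vertex of W, so deleting W costs at most r(r-1)/2 + (n-r)(r-1) edges, which is
   exactly how the bound changes from (n-r, m-s) to (n, m). Turan's theorem is the
   case s = 0, M = set0 of the same induction.

   In the equality case W is a clique and every outside vertex misses exactly one
   of its vertices. As the maximal clique can be chosen through any given edge,
   non-adjacency is transitive, so the graph is complete multipartite, and W meets
   each part exactly once. Hence a division of the parts into two balanced groups
   that works after deleting W works before. *)

Require Import Defs.
From mathcomp Require Import all_boot all_order all_algebra zify.

Set Implicit Arguments.
Unset Strict Implicit.
Unset Printing Implicit Defensive.

(** * Finite sets and ordered pairs *)

Lemma exists_subset_card (T : finType) (A B : {set T}) (k : nat) :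
  A \subset B -> #|A| <= k <= #|B| ->
  exists C : {set T}, [/\ A \subset C, C \subset B & #|C| = k].
Proof.
move=> sAB; elim: k => [|k IHk] /andP[leAk lekB].
  by exists A; split=> //; apply/eqP; rewrite -leqn0.
case: (ltnP k #|A|) => [ltkA|leAk'].
  by exists A; split=> //; apply/eqP; rewrite eqn_leq leAk.
have [|C [sAC sCB cardC]] := IHk; first by rewrite leAk' ltnW.
have /subsetPn[x xB xNC] : ~~ (B \subset C).
  by apply/negP => /subset_leq_card; rewrite cardC leqNgt lekB.
exists (x |: C); rewrite cardsU1 xNC cardC; split=> //.
  exact: subset_trans sAC (subsetUr _ _).
by apply/subsetP => y /setU1P[->|/(subsetP sCB)].
Qed.

Lemma sum_neq (I : finType) (A : {set I}) (i : I) :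
  i \in A -> \sum_(j in A) (i != j) = #|A|.-1.
Proof.
move=> iA; rewrite (cardsD1 i A) iA /= -sum1_card big_mkcond [RHS]big_mkcond /=.
apply: eq_bigr => j _; rewrite !inE eq_sym.
by case: (j \in A); case: eqP.
Qed.

(** An edge $\{x,y\}$ comes from exactly the two ordered pairs $(x,y)$ and $(y,x)$, distinct since
    adjacency is irreflexive. *)
Lemma sum_ordered_pairs (G : sgraph) :
  \sum_(x : G) \sum_(y : G) adj x y = 2 * num_edges G.
Proof.
pose P := [set p : G * G | adj p.1 p.2].
have -> : \sum_(x : G) \sum_(y : G) adj x y = #|P|.
  rewrite pair_big -sum1_card [RHS]big_mkcond /=; apply: eq_bigr => p _.
  by rewrite inE; case: (adj _ _).
pose h (p : G * G) := [set p.1; p.2].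
have EP : edges G = h @: P.
  apply/setP => f; apply/idP/imsetP; rewrite inE.
    case/existsP=> x /existsP[y /andP[xy /eqP->]]; exists (x, y) => //.
    by rewrite inE.
  case=> [[x y]]; rewrite inE /= => xy ->.
  by apply/existsP; exists x; apply/existsP; exists y; rewrite xy eqxx.
rewrite /num_edges EP -sum1_card (partition_big_imset h) /= mulnC -sum_nat_const.
apply: eq_bigr => _ /imsetP[[x y] /[!inE] /= xy ->].
have nxy : x != y by apply: contraTneq xy => ->; rewrite adj_irrefl.
rewrite sum1dep_card; transitivity #|[set (x, y); (y, x)]|; last first.
  by rewrite cards2 xpair_eqE (negPf nxy).
apply: eq_card => -[u v]; rewrite !inE /= /h /=.
  apply/andP/orP => [[uv /eqP E]|].
    have : u \in [set x; y] by rewrite -E set21.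
    have : v \in [set x; y] by rewrite -E set22.
    case/set2P=> vE /set2P[] uE; move: uv; rewrite uE vE ?adj_irrefl // !eqxx;
      by [left | right].
  by case=> /eqP[-> ->]; rewrite ?[adj y x]adj_sym // setUC.
Qed.

(** * Turán numbers and their recurrence *)

Lemma double_turan (r n : nat) :
  2 * turan r n = \sum_(i < n) \sum_(j < n) (i %% r != j %% r).
Proof. by rewrite /turan -sum_ordered_pairs. Qed.

Lemma double_turan_small (r n : nat) : n <= r -> 2 * turan r n = n * n.-1.
Proof.
move=> lenr; rewrite double_turan.
transitivity (\sum_(i < n) n.-1); last by rewrite sum_nat_const card_ord.
apply: eq_bigr => i _; have := @sum_neq 'I_n [set: 'I_n] i (in_setT _).
rewrite cardsT card_ord => <-; rewrite [RHS]big_mkcond; apply: eq_bigr => j _.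
by rewrite in_setT !modn_small ?(leq_trans (ltn_ord _) lenr).
Qed.

(** The first [r] vertices form a clique meeting every residue class once, so each of the other [n]
    vertices misses exactly one of them; a shift by [r] preserves residues. *)
Lemma double_turan_add (r n : nat) : 0 < r ->
  2 * turan r (r + n) = 2 * turan r n + r * r.-1 + 2 * (n * r.-1).
Proof.
move=> r0; rewrite !double_turan big_split_ord /=.
have mE (i : 'I_r) : i %% r = i by rewrite modn_small.
have cst k : k * r.-1 = \sum_(i < k) r.-1 by rewrite sum_nat_const card_ord.
have cross k : \sum_(i < r) (nat_of_ord i != k %% r) = r.-1.
  have := @sum_neq 'I_r [set: 'I_r] (Ordinal (ltn_pmod k r0)) (in_setT _).
  rewrite cardsT card_ord => <-; rewrite [RHS]big_mkcond.
  by apply: eq_bigr => j _; rewrite in_setT eq_sym.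
have -> : \sum_(i < r) \sum_(j < r + n) (i %% r != j %% r) = r * r.-1 + n * r.-1.
  under eq_bigr do rewrite big_split_ord /=.
  rewrite big_split /= exchange_big /=; congr (_ + _).
    rewrite (cst r); apply: eq_bigr => j _.
    by rewrite -(cross j); apply: eq_bigr => i _; rewrite mE.
  rewrite exchange_big /= (cst n); apply: eq_bigr => j _.
  by rewrite -(cross j); apply: eq_bigr => i _; rewrite mE modnDl.
have -> : \sum_(i < n) \sum_(j < r + n) ((r + i) %% r != j %% r) =
    n * r.-1 + \sum_(i < n) \sum_(j < n) (i %% r != j %% r).
  under eq_bigr do rewrite big_split_ord /=.
  rewrite big_split /=; congr (_ + _).
    rewrite (cst n); apply: eq_bigr => i _.
    by rewrite -(cross i); apply: eq_bigr => j _; rewrite mE modnDl eq_sym.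
  by apply: eq_bigr => i _; apply: eq_bigr => j _; rewrite !modnDl.
move: (\sum_(i < n) _) (r * _) (n * _) => a b d; lia.
Qed.

(* The summands of [p] are decremented simultaneously, which keeps [p] balanced
   and matches the recurrence of [double_turan_add]. *)
Lemma balanced_double_turan (I : finType) (R : {set I}) (p : I -> nat) :
  0 < #|R| -> {in R &, forall i j, p i <= p j + 1} ->
  2 * turan #|R| (\sum_(i in R) p i) + \sum_(i in R) p i * p i =
  (\sum_(i in R) p i) * (\sum_(i in R) p i).
Proof.
move=> R0; have [n] := ubnP (\sum_(i in R) p i); elim: n p => // n IHn p.
rewrite ltnS => len bal.
(* If some [p i0] is 0, balance makes every summand at most 1, so the Turán graph is complete and
   each summand equals its square. *)
have [/forallP pos|] := boolP [forall i, (i \in R) ==> (0 < p i)]; last first.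
  rewrite negb_forall => /existsP[i0]; rewrite negb_imply -leqNgt leqn0.
  case/andP=> i0R /eqP p0.
  have le1 i : i \in R -> p i <= 1 by move=> iR; have := bal i i0 iR i0R; rewrite p0.
  have -> : \sum_(i in R) p i * p i = \sum_(i in R) p i.
    by apply: eq_bigr => i /le1; case: (p i) => [|[]].
  rewrite double_turan_small; last by rewrite -sum1_card; apply: leq_sum.
  by case: (\sum_(i in R) p i) => //= k; rewrite mulnS addnC mulnC; lia.
have E1 : \sum_(i in R) p i = #|R| + \sum_(i in R) (p i).-1.
  rewrite -sum1_card -big_split; apply: eq_bigr => i iR /=.
  by rewrite add1n prednK // (implyP (pos i)).
have E2 : \sum_(i in R) p i * p i =
    #|R| + 2 * (\sum_(i in R) (p i).-1) + \sum_(i in R) (p i).-1 * (p i).-1.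
  rewrite -sum1_card big_distrr -!big_split; apply: eq_bigr => i iR /=.
  by have := implyP (pos i) iR; case: (p i) => // k _ /=; lia.
have IH := IHn (fun i => (p i).-1) _ _; rewrite E1 E2 double_turan_add //.
set a := #|R| in R0 E1 IH *; set b := \sum_(i in R) (p i).-1 in E1 IH *.
set q := \sum_(i in R) _ in IH *.
have {}IH : 2 * turan a b + q = b * b.
  apply: IH => [|i j iR jR]; first by rewrite E1 in len; lia.
  by have := bal i j iR jR; lia.
by case: (a) R0 IH => // a' _ /=; nia.
Qed.

(** * Cliques and edge counts inside vertex subsets *)

Section CliqueRemoval.
Variable G : sgraph.
Implicit Types (A B K M W : {set G}) (x y z : G).

Definition clique K := [forall x in K, forall y in K, (x != y) ==> adj x y].

(** This is $K_{k+1}$-freeness of the subgraph induced on [A], phrased on subsets so that deleting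
    vertices stays inside one fixed graph. *)
Definition cliques_le (k : nat) A := forall K, K \subset A -> clique K -> #|K| <= k.

(** [pairs A A] is twice the number of edges inside [A], while for disjoint [A] and [B] each
    crossing edge counts once. *)
Definition pairs A B := \sum_(x in A) \sum_(y in B) adj x y.

(** Non-adjacency is already reflexive and symmetric, so this says that the graph on [A] is complete
    multipartite. *)
Definition nonadj_trans A :=
  {in A & &, forall x y z, ~~ adj x y -> ~~ adj y z -> ~~ adj x z}.

Definition partite_on (I : eqType) A (c : G -> I) :=
  {in A &, forall x y, adj x y = (c x != c y)}.

Definition fiber (I : eqType) A (c : G -> I) (i : I) := [set x in A | c x == i].

Definition balanced_on (I : finType) A (c : G -> I) (S : {set I}) :=
  {in S &, forall i j, #|fiber A c i| <= #|fiber A c j| + 1}.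

Lemma cliqueP K : reflect {in K &, forall x y, x != y -> adj x y} (clique K).
Proof.
apply: (iffP forall_inP) => [h x y xK yK|h x xK].
  by move/forall_inP: (h x xK) => /(_ y yK) /implyP.
by apply/forall_inP => y yK; apply/implyP; apply: h.
Qed.

Lemma cliques_le_sub k A B : A \subset B -> cliques_le k B -> cliques_le k A.
Proof. by move=> sAB hB K sKA; apply: hB; apply: subset_trans sAB. Qed.

Lemma clique_set1 x : clique [set x].
Proof. by apply/cliqueP => y z /set1P-> /set1P->; rewrite eqxx. Qed.

Lemma cliques_le0 A : cliques_le 0 A -> A = set0.
Proof.
move=> h; apply/eqP/set0Pn => -[x xA].
by have := h [set x]; rewrite cards1 sub1set clique_set1 => /(_ xA isT).
Qed.

Lemma pairs_split A W : W \subset A ->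
  pairs A A = pairs W W + 2 * pairs (A :\: W) W + pairs (A :\: W) (A :\: W).
Proof.
move=> sWA; have AE : A :&: W = W by apply/setIidPr.
have split1 (F : G -> nat) :
    \sum_(x in A) F x = \sum_(x in W) F x + \sum_(x in A :\: W) F x.
  by rewrite (big_setID W) AE.
have sym : pairs W (A :\: W) = pairs (A :\: W) W.
  by rewrite /pairs exchange_big; do 2![apply: eq_bigr => ? _]; rewrite adj_sym.
rewrite /pairs split1; under eq_bigr do rewrite split1.
rewrite big_split /=; under [X in _ + X]eq_bigr do rewrite split1.
rewrite big_split /= -!/(pairs _ _) sym; lia.
Qed.

Lemma pairs_leqif W : pairs W W <= #|W| * #|W|.-1 ?= iff clique W.
Proof.
have -> : #|W| * #|W|.-1 = \sum_(x in W) \sum_(y in W) (x != y).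
  by rewrite -sum_nat_const; apply: eq_bigr => x xW; rewrite sum_neq.
have -> : clique W = [forall (x | x \in W), [forall (y | y \in W), adj x y == (x != y)]].
  apply: eq_forallb => x; case: (x \in W) => //=; apply: eq_forallb => y.
  by case: eqVneq => [->|]; rewrite ?adj_irrefl //=; case: (adj x y).
do 2![apply: leqif_sum => ? _]; apply/leqifP.
by case: eqP => [->//|]; case: eqVneq => [->|]; rewrite ?adj_irrefl //=; case: (adj _ _).
Qed.

Lemma pairs_compl x W :
  \sum_(y in W) adj x y + #|[set y in W | ~~ adj x y]| = #|W|.
Proof.
rewrite -!sum1_card [in X in _ + X]big_mkcond [X in X + _]big_mkcond [RHS]big_mkcond.
rewrite -big_split /=; apply: eq_bigr => y _; rewrite inE.
by case: (y \in W) => //=; case: (adj x y).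
Qed.

Lemma clique_ext_maximal K A : K \subset A -> clique K ->
  exists L : {set G}, [/\ K \subset L, L \subset A, clique L &
    {in A :\: L, forall x, exists2 y, y \in L & ~~ adj x y}].
Proof.
move=> sKA clK; pose P (L : {set G}) := (L \subset A) && clique L.
have [L /maxsetP[/andP[sLA clL] maxL] sKL] :
  {L : {set G} | maxset P L & K \subset L} by apply: maxset_exists; rewrite /P sKA.
exists L; split=> // x /setDP[xA xNL].
apply/exists_inP; apply: contraNT xNL => /exists_inPn h.
rewrite -(maxL (x |: L)) ?setU11 ?subsetUr // /P subUset sub1set xA sLA.
have adjx y : y \in L -> adj x y by move/h/negPn.
apply/cliqueP => y z /setU1P[->|yL] /setU1P[->|zL]; rewrite ?eqxx // => yz.
- exact: adjx.
- by rewrite adj_sym adjx.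
- by move/cliqueP: clL; apply.
Qed.

(** A maximal clique through [K] is padded first with vertices outside [M] until at least [q] lie
    there, then arbitrarily. Hence at most [s] of the [q + s] vertices lie in [M], and the
    non-neighbours given by maximality remain in [W]. *)
Lemma clique_padding q s A M K : M \subset A -> K \subset A -> clique K ->
  cliques_le (q + s) A -> cliques_le s M -> q <= #|A :\: M| -> q + s <= #|A| ->
  exists W : {set G}, [/\ K \subset W, W \subset A, #|W| = q + s, #|W :&: M| <= s &
    {in A :\: W, forall x, exists2 y, y \in W & ~~ adj x y}].
Proof.
move=> sMA sKA clK clA clM leqD leA.
have [L [sKL sLA clL maxL]] := clique_ext_maximal sKA clK.
have LM : #|L :&: M| <= s.
  apply: clM; first exact: subsetIr.
  by apply/cliqueP => x y /setIP[xL _] /setIP[yL _]; move/cliqueP: clL; apply.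
have leL := clA L sLA clL.
(* The [maxn] covers cliques that already have more than [q] vertices outside [M]. *)
have [|B [sLB sBA cardB]] := @exists_subset_card _ (L :\: M) (A :\: M) (maxn q #|L :\: M|)
  (setSD _ sLA).
  by rewrite leq_maxr geq_max leqD subset_leq_card // setSD.
have BM : B :&: M = set0.
  by apply/eqP; rewrite setI_eq0; move: sBA; rewrite subsetD => /andP[].
have LBE : L :|: B = (L :&: M) :|: B.
  by rewrite -{1}(setID L M) -setUA; congr (_ :|: _); apply/setUidPr.
have cardLB : #|L :|: B| <= q + s.
  rewrite LBE; apply: leq_trans (leq_card_setU _ _) _; rewrite cardB.
  have := cardsID M L; lia.
have [||W [sLW sWA cardW]] := @exists_subset_card _ (L :|: B) A (q + s).
- by rewrite subUset sLA (subset_trans sBA) // subsetDl.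
- by rewrite cardLB leA.
have /andP[sL sB] : (L \subset W) && (B \subset W) by rewrite -subUset.
exists W; split=> //; first exact: subset_trans sKL sL.
  have : #|B| <= #|W :\: M|.
    by apply: subset_leq_card; rewrite subsetD sB -setI_eq0 BM eqxx.
  rewrite cardB geq_max => /andP[leq _].
  by rewrite -(leq_add2r #|W :\: M|) cardsID cardW addnC leq_add2l.
move=> x /setDP[xA xNW]; have [|y yL nxy] := maxL x.
  by rewrite inE xA andbT; apply: contra xNW; apply: subsetP.
by exists y => //; apply: (subsetP sL).
Qed.

(* With q = r - s and k = n - m; doubled since [pairs] counts ordered pairs. *)
Definition twice_bound (q s k m : nat) :=
  2 * (m * k) + 2 * turan q k + 2 * turan s m.

(** Both Turán terms follow their recurrences. For [s = 0] there is none; the second hypothesis then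
    keeps that term at [turan 0 0] on both sides. *)
Lemma twice_boundD q s k m : 0 < q -> (s == 0) ==> (m == 0) ->
  twice_bound q s (q + k) (s + m) =
  twice_bound q s k m + (q + s) * (q + s).-1 + 2 * ((k + m) * (q + s).-1).
Proof.
move=> q0; rewrite /twice_bound double_turan_add //.
case: s => [/eqP->|s _]; last by rewrite double_turan_add //; case: q q0 => // q _; rewrite addnS /=; lia.
by rewrite addn0 /=; case: q q0 => // q _ /=; lia.
Qed.

(** Named as a predicate because it is both an input of the induction, applied inside [M], and the
    outcome of its case [s = 0]. *)
Definition turan_theorem (s : nat) := forall A, cliques_le s A ->
  pairs A A <= 2 * turan s #|A| /\
  (pairs A A = 2 * turan s #|A| ->
   nonadj_trans A /\
   forall (I : finType) (c : G -> I) (R : {set I}), partite_on A c ->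
     {in A, forall x, c x \in R} -> #|R| = s -> balanced_on A c R).

Definition divisible A q s m :=
  forall (I : finType) (c : G -> I) (R : {set I}), partite_on A c ->
    {in A, forall x, c x \in R} -> #|R| = q + s ->
  exists S : {set I}, [/\ S \subset R, #|S| = s, \sum_(i in S) #|fiber A c i| = m,
    balanced_on A c S & balanced_on A c (R :\: S)].

(** * Colourings of complete multipartite graphs *)

Lemma clique_fiber (I : finType) W (c : G -> I) (R : {set I}) :
  clique W -> partite_on W c -> {in W, forall x, c x \in R} -> #|W| = #|R| ->
  {in R, forall i, #|fiber W c i| = 1}.
Proof.
move=> clW cW cR cardW i iR.
have injc : {in W &, injective c}.
  move=> x y xW yW cxy; apply/eqP; apply/negPn/negP => nxy.
  by have := cliqueP _ clW x y xW yW nxy; rewrite cW // cxy eqxx.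
have /eqP RE : c @: W == R.
  rewrite eqEcard card_in_imset // cardW leqnn andbT.
  by apply/subsetP => _ /imsetP[x xW ->]; apply: cR.
move: iR; rewrite -RE => /imsetP[x xW ->]; apply/eqP/cards1P; exists x.
apply/setP => y; rewrite !inE; apply/andP/eqP => [[yW /eqP/injc->]|->] //.
Qed.

Lemma sum_fiber (I : finType) A (c : G -> I) (S : {set I}) :
  \sum_(i in S) #|fiber A c i| = #|[set x in A | c x \in S]|.
Proof.
rewrite -sum1_card (partition_big c (mem S)) /=; last by move=> x; rewrite inE => /andP[].
apply: eq_bigr => i iS; rewrite -sum1_card; apply: eq_bigl => x; rewrite !inE.
by case: eqP => [->|]; rewrite ?andbF // iS !andbT.
Qed.

(** Choosing one vertex of each colour gives a clique [K]. *)
Lemma card_imset_partite (I : finType) k A (c : G -> I) :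
  partite_on A c -> cliques_le k A -> #|c @: A| <= k.
Proof.
move=> cA clA.
have rep i : i \in c @: A -> exists2 x, x \in A & c x = i.
  by case/imsetP=> x xA ->; exists x.
pose f (i : I) := [pick x in A | c x == i].
pose K := [set x in A | f (c x) == Some x].
have sKA : K \subset A by apply/subsetP => x; rewrite inE => /andP[].
have clK : clique K.
  apply/cliqueP => x y; rewrite !inE => /andP[xA /eqP fx] /andP[yA /eqP fy] nxy.
  rewrite cA //; apply: contra_neq nxy => cxy.
  by move: fy; rewrite -cxy fx => -[].
apply: leq_trans (clA K sKA clK); apply: leq_trans (leq_imset_card c K).
apply: subset_leq_card; apply/subsetP => _ /imsetP[x xA ->].
have [y fE] : exists y, f (c x) = Some y.
  rewrite /f; case: pickP => [y _|/(_ x)]; first by exists y.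
  by rewrite xA eqxx.
have /andP[yA /eqP cy] : (y \in A) && (c y == c x).
  by move: fE; rewrite /f; case: pickP => // z hz [<-].
by rewrite -cy; apply: imset_f; rewrite inE yA cy fE eqxx.
Qed.

(** Each vertex outside [W] has at most [#|W|.-1] neighbours in [W]. Equality leaves no slack in
    these bounds, nor in the count inside [W]. *)
Lemma pairs_clique_removal A W : W \subset A ->
  {in A :\: W, forall x, exists2 y, y \in W & ~~ adj x y} ->
  pairs A A <= pairs (A :\: W) (A :\: W) + #|W| * #|W|.-1
               + 2 * (#|A :\: W| * #|W|.-1) /\
  (pairs A A = pairs (A :\: W) (A :\: W) + #|W| * #|W|.-1
               + 2 * (#|A :\: W| * #|W|.-1) ->
   clique W /\ {in A :\: W, forall x, {in W &, forall y z,
     ~~ adj x y -> ~~ adj x z -> y = z}}).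
Proof.
move=> sWA nadj; rewrite (pairs_split sWA).
have [leW eqW] := pairs_leqif W.
have degW x : x \in A :\: W -> \sum_(y in W) adj x y <= #|W|.-1.
  case/nadj=> w wW nxw; have := pairs_compl x W.
  suff : 0 < #|[set y in W | ~~ adj x y]| by lia.
  by apply/card_gt0P; exists w; rewrite inE wW.
have leD : pairs (A :\: W) W <= #|A :\: W| * #|W|.-1.
  by rewrite -sum_nat_const; apply: leq_sum.
split=> [|eqA]; first by lia.
have {}eqW : clique W by rewrite -eqW; apply/eqP; lia.
split=> // x xD y z yW zW nxy nxz; apply/eqP/negPn/negP => nyz.
have : pairs (A :\: W) W < #|A :\: W| * #|W|.-1; last by lia.
rewrite -sum_nat_const /pairs (bigD1 x) // [X in _ < X](bigD1 x) //=.
rewrite -addSn leq_add //; last by apply: leq_sum => u /andP[/degW].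
have := pairs_compl x W.
suff : 1 < #|[set y in W | ~~ adj x y]| by lia.
have <- : #|[set y; z]| = 2 by rewrite cards2 nyz.
by apply: subset_leq_card; apply/subsetP => u /set2P[]->; rewrite inE ?yW ?zW.
Qed.

(** * Induction on the vertex set *)

Lemma turan_theorem0 : turan_theorem 0.
Proof.
move=> A /cliques_le0->; rewrite /pairs big_set0; split=> // _.
split=> [x|I c R _ _ /eqP]; first by rewrite inE.
by rewrite cards_eq0 => /eqP-> i j; rewrite inE.
Qed.

(** On at most [q] vertices [turan q] counts a complete graph, so the edges inside [M], outside it
    and across can be bounded separately. Equality makes the outside a clique joined completely to
    [M]. *)
Lemma few_vertices_outside q s A M : turan_theorem s -> M \subset A ->
  cliques_le s M -> #|A :\: M| <= q ->
  pairs A A <= twice_bound q s #|A :\: M| #|M| /\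
  (pairs A A = twice_bound q s #|A :\: M| #|M| ->
   nonadj_trans A /\ divisible A q s #|M|).
Proof.
move=> turan_s sMA clM leDq; set D := A :\: M.
have [leM eqM] := turan_s M clM.
have [leD eqD] := pairs_leqif D.
have leDM x : x \in D -> \sum_(y in M) adj x y <= #|M|.
  by move=> _; rewrite -sum1_card; apply: leq_sum => y _; case: adj.
have leX : pairs D M <= #|M| * #|D|.
  by rewrite mulnC -sum_nat_const; apply: leq_sum.
rewrite /twice_bound (pairs_split sMA) -/D double_turan_small //.
split=> [|eqA]; first by lia.
have [|nadjM balM] := eqM; first by lia.
have /cliqueP clD : clique D by rewrite -eqD; apply/eqP; lia.
have adjDM : {in D & M, forall x y, adj x y}.
  move=> x y xD yM; apply/negPn/negP => nxy.
  have : pairs D M < #|M| * #|D|; last by lia.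
  rewrite mulnC -sum_nat_const /pairs (bigD1 x) // [X in _ < X](bigD1 x) //=.
  rewrite -addSn leq_add //; last by apply: leq_sum => u /andP[/leDM].
  have := pairs_compl x M.
  suff : 0 < #|[set y in M | ~~ adj x y]| by lia.
  by apply/card_gt0P; exists y; rewrite inE yM.
have adjD x y : x \in D -> y \in A -> ~~ adj x y -> x = y.
  move=> xD yA; have [yM|yNM] := boolP (y \in M); first by rewrite adjDM.
  have yD : y \in D by rewrite inE yNM.
  by apply: contraNeq; apply: clD.
have memD x : x \in A -> x \notin M -> x \in D by move=> xA xNM; rewrite inE xNM.
split=> [x y z xA yA zA nxy nyz|I c R cA cR cardR].
  have [yM|yD] := boolP (y \in M); last first.
    by rewrite -(adjD y z) ?memD.
  have [xM|xD] := boolP (x \in M); last by rewrite (adjD x y) ?memD.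
  have [zM|zD] := boolP (z \in M); first exact: nadjM nxy nyz.
  by rewrite (adjD z y) ?memD // adj_sym.
have sDA : D \subset A := subsetDl _ _.
have cM : partite_on M c by move=> x y /(subsetP sMA) ? /(subsetP sMA) ?; apply: cA.
have cMD x y : x \in D -> y \in M -> c x != c y.
  move=> xD yM; rewrite -cA ?adjDM //; first exact: (subsetP sDA).
  exact: (subsetP sMA).
(* The colours of [M] and of [D] are disjoint, at most [s] and at most [q] in number, so [s] labels
   can be chosen that contain the former and avoid the latter. *)
have [||S [sMS sSR cardS]] := @exists_subset_card _ (c @: M) (R :\: c @: D) s.
- apply/subsetP => _ /imsetP[y yM ->]; rewrite inE cR ?(subsetP sMA) // andbT.
  by apply/negP => /imsetP[x xD E]; have := cMD x y xD yM; rewrite E eqxx.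
- rewrite card_imset_partite //=; have := leq_imset_card c D.
  have := cardsD R (c @: D); have := subset_leq_card (subsetIr R (c @: D)).
  rewrite -/D in leDq *; lia.
move: sSR; rewrite subsetD => /andP[sSR disjSD].
have cSM x : x \in A -> (c x \in S) = (x \in M).
  move=> xA; have [xM|xNM] := boolP (x \in M).
    by apply: (subsetP sMS); apply: imset_f.
  apply/negP => xS; move/disjoint_setI0: disjSD => /setP/(_ (c x)).
  by rewrite !inE xS imset_f ?memD.
have fibS i : i \in S -> fiber A c i = fiber M c i.
  move=> iS; apply/setP => x; rewrite !inE; case: eqP; rewrite ?andbF // !andbT.
  move=> ci; apply/idP/idP => [xA|/(subsetP sMA)//].
  by rewrite -cSM // ci.
exists S; split=> //.
- rewrite sum_fiber; apply: eq_card => x; rewrite inE.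
  have [xA|xNA] := boolP (x \in A); first by rewrite cSM.
  by apply/esym/negP => /(subsetP sMA); rewrite (negPf xNA).
- move=> i j iS jS; rewrite !fibS //; apply: (balM I c S) => // x xM.
  by apply: (subsetP sMS); apply: imset_f.
(* A part outside [S] lies in [D], where non-adjacent vertices coincide, so it has at most one
   vertex. *)
- move=> i j /setDP[iR iNS] _; apply: leq_trans (leq_addl _ _).
  rewrite leqNgt; apply/negP => /card_gt1P[x [y []]]; rewrite !inE.
  move=> /andP[xA /eqP cx] /andP[yA /eqP cy]; apply/negP; rewrite negbK.
  apply/eqP; apply: adjD => //; last by rewrite cA // cx cy eqxx.
  by apply: memD => //; rewrite -cSM // cx.
Qed.

(** The last hypothesis is $sn\le rm$ after cancelling $sm$. With $k=n-m$, it survives passing from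
    $(k,m)$ to $(k-q,m-s)$, and it gives $m\ge s$ once $k\ge q$. *)
Lemma clique_removal_induction q s A M : 0 < q -> turan_theorem s ->
  M \subset A -> cliques_le (q + s) A -> cliques_le s M ->
  s * #|A :\: M| <= q * #|M| ->
  pairs A A <= twice_bound q s #|A :\: M| #|M| /\
  (pairs A A = twice_bound q s #|A :\: M| #|M| ->
   nonadj_trans A /\ divisible A q s #|M|).
Proof.
move=> q0 turan_s; have [n] := ubnP #|A|; elim: n A M => // n IHn A M leAn.
move=> sMA clA clM lesq.
have [leDq|/ltnW leqD] := leqP #|A :\: M| q; first exact: few_vertices_outside.
have lesM : s <= #|M|.
  by rewrite -(leq_pmul2l q0); apply: leq_trans lesq; rewrite mulnC leq_mul.
have cardA := cardsID M A; rewrite (setIidPr sMA) in cardA.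
have leA : q + s <= #|A| by rewrite -cardA addnC leq_add.
have [k kE] : exists k, #|A :\: M| = q + k by exists (#|A :\: M| - q); rewrite subnKC.
have [m mE] : exists m, #|M| = s + m by exists (#|M| - s); rewrite subnKC.
have sm : (s == 0) ==> (m == 0).
  apply/implyP => /eqP s0; move: clM mE; rewrite s0 => /cliques_le0->.
  by rewrite cards0 add0n => <-.
(* The clique [K] is left free so that in the equality case the removed set can
   be taken through a given edge. *)
have step K : K \subset A -> clique K -> exists W : {set G},
    [/\ K \subset W, W \subset A, #|W| = q + s,
      pairs A A <= twice_bound q s #|A :\: M| #|M| &
      pairs A A = twice_bound q s #|A :\: M| #|M| ->
      [/\ clique W, {in A :\: W, forall x, {in W &, forall y z,
            ~~ adj x y -> ~~ adj x z -> y = z}} &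
          divisible (A :\: W) q s m]].
  move=> sKA clK.
  have [W [sKW sWA cardW WM nadj]] := clique_padding sMA sKA clK clA clM leqD leA.
  exists W.
  have cardAW : #|A :\: W| = k + m.
    by have := cardsID W A; rewrite (setIidPr sWA) cardW; lia.
  (* [W] may contain fewer than [s] vertices of [M], so [M'] keeps exactly [m] of the remaining
     ones; the others now count as outside. *)
  have [||M' [_ sM'M cardM']] := @exists_subset_card _ set0 (M :\: W) m.
  - exact: sub0set.
  - rewrite cards0 /=; have := cardsID W M; rewrite setIC; lia.
  have sM'A : M' \subset A :\: W by apply: subset_trans sM'M (setSD _ _).
  have cardD' : #|(A :\: W) :\: M'| = k.
    have := cardsID M' (A :\: W); rewrite (setIidPr sM'A); lia.
  have [||||leA' eqA'] := IHn (A :\: W) M' _ sM'A.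
  - lia.
  - exact: cliques_le_sub (subsetDl _ _) clA.
  - apply: cliques_le_sub clM; exact: subset_trans sM'M (subsetDl _ _).
  - rewrite cardD' cardM'; move: lesq; rewrite kE mE; nia.
  have [leR eqR] := pairs_clique_removal sWA nadj.
  rewrite cardD' cardM' in leA' eqA'; rewrite cardAW cardW in leR eqR.
  rewrite kE mE twice_boundD //; split=> // [|eqA]; first by lia.
  have [clW nadj1] := eqR (ltac:(lia)).
  by have [_ ?] := eqA' (ltac:(lia)).
have [W [_ sWA cardW leAA eqAA]] := step set0 (sub0set _) (ltac:(by apply/cliqueP => x y; rewrite inE)).
split=> // eqA; split=> [x y z xA yA zA nxy nyz|I c R cA cR cardR].
  (* The removed clique is taken through the supposed edge [xz]. If [y] is outside it, then [y]
     misses two of its vertices; if inside, [y] equals [x] or is adjacent to it. Each case is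
     contradictory. *)
  apply/negP => xz; have nxz : x != z by apply: contraTneq xz => ->; rewrite adj_irrefl.
  have [||W' [sKW' _ _ _ /(_ eqA)[clW' nadj _]]] := step [set x; z].
  - by apply/subsetP => u /set2P[]->.
  - apply/cliqueP => u v /set2P[]-> /set2P[]->; rewrite ?eqxx // => _.
    by rewrite adj_sym.
  have xW : x \in W' by apply: (subsetP sKW'); rewrite set21.
  have zW : z \in W' by apply: (subsetP sKW'); rewrite set22.
  have [yW|yNW] := boolP (y \in W'); last first.
    move/eqP: nxz; apply; apply: (nadj y) => //; first by rewrite inE yNW.
    by rewrite adj_sym.
  case: (eqVneq x y) => [xy|xy]; first by rewrite -xy xz in nyz.
  by rewrite (cliqueP _ clW') in nxy.
have [clW nadj divAW] := eqAA eqA.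
have sDA := subsetDl A W.
have cW : partite_on W c by move=> x y /(subsetP sWA) ? /(subsetP sWA) ?; apply: cA.
have cD : partite_on (A :\: W) c.
  by move=> x y /(subsetP sDA) ? /(subsetP sDA) ?; apply: cA.
(* The clique [W] has as many vertices as there are labels, so every part loses exactly one
   vertex. *)
have fib i : i \in R -> #|fiber A c i| = #|fiber (A :\: W) c i| + 1.
  move=> iR; rewrite -(@clique_fiber I W c R _ _ _ _ i) ?cardW ?cardR //; last first.
    by move=> x /(subsetP sWA)/cR.
  rewrite -(cardsID W (fiber A c i)) addnC; congr (_ + _); apply: eq_card => x.
    by rewrite !inE andbA.
  rewrite !inE andbAC; congr (_ && _); case: (boolP (x \in W)); rewrite ?andbF //.
  by move/(subsetP sWA)->.
have [|S [sSR cardS sumS balS balR]] := divAW I c R cD _ cardR.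
  by move=> x /(subsetP sDA)/cR.
exists S; split=> //.
- rewrite (eq_bigr (fun i => #|fiber (A :\: W) c i| + 1)) => [|i /(subsetP sSR)/fib//].
  by rewrite big_split /= sumS sum1_card cardS mE addnC.
- by move=> i j iS jS; rewrite !fib ?(subsetP sSR) // leq_add2r balS.
- move=> i j iS jS; have [[iR _] [jR _]] := (setDP iS, setDP jS).
  by rewrite !fib // leq_add2r balR.
Qed.

Lemma turan_theorem_holds s : turan_theorem s.
Proof.
case: s => [|s]; first exact: turan_theorem0.
move=> A clA; have turan0 : turan 0 0 = 0.
  by apply/eqP; have := @double_turan_small 0 0 (leqnn _); lia.
(* With [M] empty, the group [S] has no labels and the other group is all of [R]. *)
have [||||le eq] := @clique_removal_induction s.+1 0 A set0 isT turan_theorem0.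
- exact: sub0set.
- by rewrite addn0.
- by move=> K; rewrite subset0 => /eqP->; rewrite cards0.
- by rewrite mul0n.
rewrite /twice_bound setD0 cards0 mul0n muln0 add0n turan0 // addn0 in le eq.
split=> // /eq[nadj divA]; split=> // I c R cA cR cardR.
have [|S [_ /eqP]] := divA I c R cA cR; first by rewrite addn0.
by rewrite cards_eq0 => /eqP-> _ _; rewrite setD0.
Qed.
End CliqueRemoval.

(** * From forbidden subgraphs to cliques, and back to partitions *)

Lemma graph_free_cliques_le (k : nat) (G : sgraph) :
  graph_free (complete_graph k.+1) G -> cliques_le k [set: G].
Proof.
move=> free K _ /cliqueP clK; rewrite leqNgt; apply: contra free => ltkK.
pose f (i : 'I_k.+1) : G := enum_val (widen_ord ltkK i).
have injf : injective f by move=> i j /enum_val_inj[/val_inj].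
apply/existsP; exists [ffun i => f i]; apply/andP; split.
  by apply/injectiveP => i j; rewrite !ffunE => /injf.
apply/forallP => i; apply/forallP => j; apply/implyP => nij; rewrite !ffunE.
by apply: clK; rewrite ?enum_valP // (inj_eq injf).
Qed.

Lemma induced_free_cliques_le (k : nat) (G : sgraph) (M : {set G}) :
  graph_free (complete_graph k.+1) (induced M) -> cliques_le k M.
Proof.
move=> /graph_free_cliques_le clM K sKM /cliqueP clK.
pose K' : {set induced M} := [set u | val u \in K].
have <- : #|K'| = #|K|.
  rewrite -(card_imset K' val_inj); apply: eq_card => x.
  apply/imsetP/idP => [[u]|xK]; first by rewrite inE => uK ->.
  by exists (exist _ x (subsetP sKM x xK)); rewrite ?inE.
apply: clM; rewrite ?subsetT //; apply/cliqueP => u v; rewrite !inE => uK vK.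
by rewrite -val_eqE; apply: clK.
Qed.

Lemma exists_card_cliques_le (s m : nat) (G : sgraph) : m <= alpha s G ->
  exists2 M : {set G}, #|M| = m & cliques_le s M.
Proof.
move=> lem; suff [M0 leM0 clM0] : exists2 M : {set G}, m <= #|M| & cliques_le s M.
  have [||M [_ sM <-]] := @exists_subset_card _ set0 M0 m; rewrite ?sub0set ?cards0 //.
  by exists M => //; apply: cliques_le_sub clM0.
(* An empty maximum has value 0, so only a positive [m] yields a witness from [alpha]; for 0 the
   empty set serves. *)
case: m lem => [|m] lem.
  by exists set0 => // K; rewrite subset0 => /eqP->; rewrite cards0.
have [/existsP[M /andP[freeM leM]]|/existsPn noM] := boolP [exists M : {set G},
    graph_free (complete_graph s.+1) (induced M) && (m < #|M|)].
  by exists M => //; apply: induced_free_cliques_le.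
move: lem; rewrite ltnNge => /negP[]; apply/bigmax_leqP => M freeM.
by have := noM M; rewrite freeM -leqNgt.
Qed.

(** The set of non-neighbours of [x] is its class and serves as its colour. At most [r] colours
    occur, so their ranks are labels in ['I_r]. *)
Lemma nonadj_trans_partite (r : nat) (G : sgraph) :
  cliques_le r [set: G] -> nonadj_trans [set: G] ->
  exists c : G -> 'I_r, complete_partite c.
Proof.
move=> clG trG; pose c0 (x : G) := [set y | ~~ adj x y].
have c0E x y : adj x y = (c0 x != c0 y).
  apply/idP/idP => [xy|].
    apply/eqP => /setP/(_ x); rewrite !inE adj_irrefl adj_sym; move: xy.
    by rewrite adj_sym => ->.
  apply: contraR => nxy; apply/eqP/setP => z; rewrite !inE.
  apply/idP/idP; last by apply: trG; rewrite ?inE.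
  by apply: trG; rewrite ?inE // adj_sym.
have lec : #|c0 @: [set: G]| <= r.
  by apply: card_imset_partite clG => x y _ _; apply: c0E.
pose im x := imset_f c0 (in_setT x).
exists (fun x => widen_ord lec (enum_rank_in (im x) (c0 x))) => x y.
rewrite c0E; congr (~~ _); apply/eqP/eqP => [E|[/val_inj E]].
  apply: val_inj => /=; congr (nat_of_ord _); apply: enum_val_inj; rewrite !enum_rankK_in ?im //.
by rewrite -(enum_rankK_in (im x) (im x)) E enum_rankK_in ?im.
Qed.

(** Every ordered pair of vertices is either adjacent or inside one part. *)
Lemma complete_partite_pairs (r : nat) (G : sgraph) (c : G -> 'I_r) :
  complete_partite c ->
  2 * num_edges G + \sum_i #|part c i| * #|part c i| = #|G| * #|G|.
Proof.
move=> cG; rewrite -sum_ordered_pairs.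
have -> : \sum_i #|part c i| * #|part c i| = \sum_(x : G) \sum_(y : G) (c x == c y).
  rewrite [RHS](partition_big c predT) //=; apply: eq_bigr => i _.
  rewrite -sum_nat_const; apply: eq_big => [x|x]; rewrite inE // => /eqP <-.
  rewrite -sum1_card big_mkcond; apply: eq_bigr => y _.
  by rewrite inE eq_sym; case: eqP.
rewrite -big_split -sum_nat_const; apply: eq_bigr => x _ /=.
rewrite -big_split -sum1_card; apply: eq_bigr => y _ /=.
by rewrite cG; case: eqP.
Qed.

Theorem theorem1 (r s n m : nat) (G : sgraph)
    (hs : 1 <= s) (hsr : s < r)
    (hn : #|G| = n)
    (hfree : graph_free (complete_graph r.+1) G)
    (hmalpha : m <= alpha s G)
    (hm : (Num.ceil ((s * n)%:R / r%:R : rat) <= m%:Z)%R) :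
  num_edges G <= m * (n - m) + turan (r - s) (n - m) + turan s m
  /\
  (num_edges G = m * (n - m) + turan (r - s) (n - m) + turan s m
   <->
   exists (c : G -> 'I_r) (S : {set 'I_r}),
     [/\ complete_partite c,
         #|S| = s /\ #|~: S| = r - s,
         \sum_(i in S) #|part c i| = m /\ balanced c S
       & \sum_(i in ~: S) #|part c i| = n - m /\ balanced c (~: S)]).
Proof.
have r0 : 0 < r by apply: leq_ltn_trans hsr.
have lesn : s * n <= m * r.
  move: hm; rewrite Num.Theory.ceil_le_int Num.Theory.ler_pdivrMr.
    by rewrite -GRing.natrM Num.Theory.ler_nat.
  by rewrite Num.Theory.ltr0n.
have clG := graph_free_cliques_le hfree.
have [M cardM clM] := exists_card_cliques_le hmalpha.
have lemn : m <= n by rewrite -cardM -hn max_card.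
have cardC : #|[set: G] :\: M| = n - m by rewrite setTD cardsCs setCK hn cardM.
have rE : r - s + s = r by rewrite subnK // ltnW.
have [|||leE eqE] := @clique_removal_induction G (r - s) s [set: G] M _
  (@turan_theorem_holds G s) (subsetT _) _ clM; rewrite ?subn_gt0 ?rE //.
  by rewrite cardC cardM mulnBl mulnBr leq_sub2r // [r * m]mulnC.
have EG : pairs [set: G] [set: G] = 2 * num_edges G.
  rewrite -sum_ordered_pairs /pairs; apply: eq_big => [x|x _]; rewrite ?inE //.
  by apply: eq_bigl => y; rewrite inE.
rewrite EG cardC cardM /twice_bound in leE eqE.
split; first by lia.
split=> [eqG|[c [S [cG [cS cNS] [sumS balS] [sumNS balNS]]]]].
  have [|tr divG] := eqE; first by lia.
  have [c cG] := nonadj_trans_partite clG tr.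
  have fibE i : fiber [set: G] c i = part c i by apply/setP => x; rewrite !inE.
  have [|||S [_ cS sumS balS balNS]] := divG 'I_r c [set: 'I_r].
  - by move=> x y _ _; apply: cG.
  - by move=> x _; rewrite inE.
  - by rewrite cardsT card_ord rE.
  have balE (P : {set 'I_r}) : balanced_on [set: G] c P -> balanced c P.
    by move=> b i j iP jP; have := b i j iP jP; rewrite !fibE.
  have sumE (P : {set 'I_r}) :
      \sum_(i in P) #|part c i| = #|[set x in [set: G] | c x \in P]|.
    by rewrite -sum_fiber; apply: eq_bigr => i _; rewrite fibE.
  rewrite sum_fiber -sumE in sumS.
  exists c, S; split=> //.
  - by split=> //; rewrite cardsCs setCK cS card_ord.
  - by split=> //; apply: balE.
  - split; last by apply: balE; rewrite -setTD.
    rewrite -hn -sumS !sumE [LHS]cardsCs; congr (_ - #|pred_of_set _|).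
    by apply/setP => x; rewrite !inE negbK.
(* Here $2e(G)=n^2-\sum_i|V_i|^2$, and in each balanced group the sum of squares is the squared
   total minus twice the Turán number. Expanding $n^2$ leaves the cross term $2m(n-m)$. *)
have := complete_partite_pairs cG; rewrite hn.
have -> : \sum_i #|part c i| * #|part c i| =
    \sum_(i in S) #|part c i| * #|part c i| + \sum_(i in ~: S) #|part c i| * #|part c i|.
  by rewrite (bigID (mem S)); congr (_ + _); apply: eq_bigl => i; rewrite !inE.
have := balanced_double_turan _ balS; have := balanced_double_turan _ balNS.
rewrite cS cNS subn_gt0 sumS sumNS => /(_ hsr) + /(_ hs).
have [k nE] : exists k, n = m + k by exists (n - m); rewrite subnKC.
rewrite nE addKn.
set a := \sum_(i in S) _; set b := \sum_(i in ~: S) _; lia.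
Qed.
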